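(* Let $L_n(x)$ be the left peak polynomials. Then for $n\ge1$, $$L_n(x)=\sum_{T\in\mathrm{SYT}(n)}\left(\prod_{i=1}^n\sigma_i(T)\right)x^{\frac12\left(n-\sum_{i\ge0}w_{2i+1}(T)\right)}.$$
   Context: $L_n(x)=\sum_{\pi\in\mathfrak S_n}x^{\mathrm{lpk}(\pi)}$, where $\mathfrak S_n$ is the symmetric group on $[n]$ and $\mathrm{lpk}(\pi)=\#\{i\in[n-1]:\pi(i-1)<\pi(i)>\pi(i+1)\}$ with $\pi(0)=0$. A standard Young tableau of size $n$ is a filling of the Ferrers diagram of a partition $\lambda\vdash n$ (French convention: left-justified rows numbered from bottom to top, $\lambda_i$ boxes in row $i$) with $1,\dots,n$, each used exactly once, increasing from left to right in rows and from bottom to top in columns; $\mathrm{SYT}(n)$ is the set of all of them, over all $\lambda\vdash n$. For $T\in\mathrm{SYT}(n)$, $w_i(T)$ is the number of rows of $T$ with exactly $i$ boxes, $T_i$ is the tableau obtained from $T$ by deleting the entries $i+1,\dots,n$, and $\mathrm{col}_k(T_i)$ is the number of boxes in the $k$-th column of $T_i$. The box sorting index of $i$ is $$\sigma_i(T)=\begin{cases} i-\mathrm{col}_1(T_i)+1, & \text{if } i \text{ is in the first column of } T,\\ \mathrm{col}_k(T_i)-\mathrm{col}_{k+1}(T_i)+1, & \text{if } i \text{ is in the } (k+1)\text{-th column of } T,\ k\ge1.\end{cases}$$ *)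

(* Defs.v *)
From mathcomp Require Import all_boot all_order all_fingroup all_algebra.

Set Implicit Arguments.
Unset Strict Implicit.
Unset Printing Implicit Defensive.

(* [pval p i] is p(i) for p a permutation of {1, ..., n}, extended by p(0) = 0;
   a permutation of 'I_n acts on {0, ..., n-1}, hence the shift by one. *)
Definition pval n (p : 'S_n) (i : nat) : nat :=
  nth 0 (0 :: [seq (p j : nat).+1 | j <- enum 'I_n]) i.

Definition lpk n (p : 'S_n) : nat :=
  count (fun i => (pval p i.-1 < pval p i) && (pval p i.+1 < pval p i))
        (index_iota 1 n).

Definition left_peak_poly n : {poly int} :=
  (\sum_(p : 'S_n) 'X^(lpk p))%R.

(* A tableau is the list of its rows, in French convention: the first list is
   the bottom row. Columns are numbered from 1; a row has a box in column k iff
   its length is at least k. *)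
Definition column (T : seq (seq nat)) (k : nat) : seq nat :=
  [seq nth 0 r k.-1 | r <- T & k <= size r].

Definition col (k : nat) (T : seq (seq nat)) : nat := size (column T k).

(* The first two conditions say that the row lengths form a partition; it is a
   partition of n by the third one. Columns beyond the n-th are empty. *)
Definition is_syt (n : nat) (T : seq (seq nat)) : bool :=
  [&& [::] \notin T,
      sorted geq (shape T),
      perm_eq (flatten T) (iota 1 n),
      all (sorted ltn) T &
      all (fun k => sorted ltn (column T k)) (iota 1 n)].

(* A tableau of size n has at most n rows, of length at most n, with entries at
   most n, so that SYT(n) embeds in the following finite type. *)
Definition filling (n : nat) : finType := {bseq n of {bseq n of 'I_n.+1}}.

Definition rows n (T : filling n) : seq (seq nat) :=
  [seq map (@nat_of_ord n.+1) r | r : {bseq n of 'I_n.+1} <- T].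

Definition SYT (n : nat) : {set filling n} := [set T | is_syt n (rows T)].

Definition w (i : nat) (T : seq (seq nat)) : nat :=
  count (fun r => size r == i) T.

Definition restrict (i : nat) (T : seq (seq nat)) : seq (seq nat) :=
  [seq r <- [seq [seq x <- r | x <= i] | r <- T] | r != [::]].

Definition row_with (i : nat) (T : seq (seq nat)) : seq nat :=
  nth [::] T (find (fun r => i \in r) T).

(* The natural-number subtractions are exact when T is a standard Young tableau
   and i one of its entries: T_i has i boxes and its column lengths weakly
   decrease. [index] counts from 0, columns from 1. *)
Definition sigma (i : nat) (T : seq (seq nat)) : nat :=
  let Ti := restrict i T in
  if index i (row_with i T) is k.+1 then (col k.+1 Ti - col k.+2 Ti).+1
  else (i - col 1 Ti).+1.

(* The number of odd rows is at most n and has the parity of n, so the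
   subtraction and the halving are exact; no row is longer than n, so that the
   sum over i < n accounts for all the odd rows. *)
Definition lpk_exponent (n : nat) (T : seq (seq nat)) : nat :=
  (n - \sum_(0 <= i < n) w i.*2.+1 T)./2.

(* Main.v *)
Require Import Defs.
From mathcomp Require Import all_boot all_order all_fingroup all_algebra.
From mathcomp Require Import zify ring.

Import GRing.Theory.

(** Both sides satisfy the recurrence
    F_(n+1) = (1 + n X) F_n + 2 X (1 - X) F_n'  with F_0 = 1,
    whose right-hand side is the linear operator [left_peak_step n]; on a
    monomial it is X^k |-> (2k+1) X^k + (n-2k) X^(k+1).

    For permutations, insert n+1 into one of the n+1 gaps of a word of length n
    with k left peaks. The largest letter becomes a peak unless it comes last.
    Each of the 2k gaps next to a peak trades that peak for the new one, and the
    final gap changes nothing, so 2k+1 gaps keep k; the other n-2k gaps create a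
    peak. This is [sum_peaks_insertions].

    For tableaux, the exponent is the sum of the halves, rounded down, of the
    row lengths ([lpk_exponentE]), because n is the sum of the row lengths. A
    tableau of size n+1 arises from exactly one tableau T of size n by putting
    n+1 at the end of the first row of some length c, or in a new row when
    c = 0 ([perm_syts]). The old box sorting indices do not change. The new one
    is the number of rows of T of length c, or n+1 minus the number of rows when
    c = 0 ([sigma_grow_new]). So, summed over c, the new index distributes its
    weight over all the rows of T, one unit each, plus n+1 minus the number of
    rows for the new row. The exponent rises by one exactly when c is odd, and
    T has n-2k odd rows if k is its exponent. Hence the total weight n+1 splits
    into n-2k for k+1 and 2k+1 for k, which is [sum_corners]. *)

(** * The recurrence operator *)

Definition left_peak_step (n : nat) (P : {poly int}) : {poly int} :=
  ((1 + n%:R * 'X) * P + 2%:R * 'X * (1 - 'X) * P^`())%R.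

Lemma left_peak_stepXn n k :
  (left_peak_step n 'X^k = 'X^k * (1 + 2%:R * k%:R) + 'X^(k.+1) * (n%:R - 2%:R * k%:R))%R.
Proof.
rewrite /left_peak_step derivXn -mulr_natr; case: k => [|k]; first by rewrite expr0 expr1; ring.
rewrite /= !exprS; ring.
Qed.

Lemma left_peak_step_sum n (I : Type) (r : seq I) (F : I -> {poly int}) :
  left_peak_step n (\sum_(i <- r) F i)%R = (\sum_(i <- r) left_peak_step n (F i))%R.
Proof. by rewrite /left_peak_step raddf_sum !mulr_sumr -big_split. Qed.

Lemma left_peak_stepMn n P k : left_peak_step n (P *+ k)%R = (left_peak_step n P *+ k)%R.
Proof. by rewrite /left_peak_step derivMn !mulrnAr -mulrnDl. Qed.

(** * Left peaks and insertion of the largest letter *)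

(** Carrying the preceding letter [x] makes the number of peaks structurally
    recursive in the word. *)
Fixpoint peaks (x : nat) (s : seq nat) : nat :=
  if s is y :: s' then
    (if s' is z :: _ then (x < y) && (z < y) else false) + peaks y s'
  else 0.

Definition word {n} (p : 'S_n) : seq nat :=
  [seq (p j : nat).+1 | j <- enum 'I_n].

Lemma peaks_cons2 x y z s :
  peaks x [:: y, z & s] = ((x < y) && (z < y)) + peaks y (z :: s).
Proof. by []. Qed.

Lemma count_peaks x s :
  count (fun i => let v := nth 0 (x :: s) in (v i.-1 < v i) && (v i.+1 < v i))
    (index_iota 1 (size s)) = peaks x s.
Proof.
have -> a : index_iota 1 a = [seq i.+1 | i <- iota 0 a.-1].
  by rewrite /index_iota subn1 -[1]addn0 iotaDl.
rewrite count_map; elim: s x => [|y [|z s] IHs] x //.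
rewrite peaks_cons2 -IHs -[(size [:: y, z & s]).-1]/(size s).+1 /=.
congr (_ + _); rewrite -[1]addn0 iotaDl count_map.
exact: eq_count.
Qed.

Lemma lpk_peaks n (p : 'S_n) : lpk p = peaks 0 (word p).
Proof.
rewrite -count_peaks /word size_map size_enum_ord.
exact: eq_count.
Qed.

(** The words of permutations are distinct rearrangements of 1, ..., n, and
    there are n! of them, so they are all the rearrangements. *)
Lemma perm_words n : perm_eq [seq word p | p : 'S_n] (permutations (iota 1 n)).
Proof.
have uW : uniq [seq word p | p : 'S_n].
  rewrite map_inj_uniq ?enum_uniq // => p q /eq_in_map epq.
  by apply/permP => j; apply/val_inj/succn_inj/epq; rewrite mem_enum.
have [] // := @uniq_min_size _ _ (permutations (iota 1 n)) uW; first last.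
- by move=> _; apply: uniq_perm => //; apply: permutations_uniq.
- rewrite size_permutations ?iota_uniq // size_iota size_map -cardE.
  by rewrite card_Sn.
move=> _ /mapP[p _ ->].
rewrite mem_permutations -[1]addn0 iotaDl -val_enum_ord -map_comp.
rewrite /word (map_comp (fun j : 'I_n => (j : nat).+1) p); apply: perm_map.
apply: uniq_perm; [by rewrite (map_inj_uniq perm_inj) enum_uniq | exact: enum_uniq |].
move=> j; rewrite mem_enum; apply/mapP; exists (p^-1%g j); rewrite ?mem_enum //.
by rewrite permKV.
Qed.

Fixpoint insertions (m : nat) (s : seq nat) : seq (seq nat) :=
  (m :: s) :: if s is x :: s' then [seq x :: t | t <- insertions m s'] else [::].

Lemma insertions_uniq m s : m \notin s -> uniq (insertions m s).
Proof.
elim: s => [|x s IHs] //=; rewrite inE negb_or => /andP[mx ms].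
rewrite map_inj_uniq ?IHs ?andbT //; last by move=> ? ? [].
by apply/mapP => -[t _ [mx']]; rewrite mx' eqxx in mx.
Qed.

(** Deleting [m] undoes an insertion, which makes insertion bijective. *)
Lemma mem_insertions m s t : m \notin s ->
  (t \in insertions m s) = (m \in t) && (rem m t == s).
Proof.
elim: s t => [|x s IHs] [|y t] /=; rewrite ?inE ?orbF //.
  move=> _; rewrite eqseq_cons [m == y]eq_sym.
  by case: eqVneq => //= _; rewrite andbF.
  by move=> _; apply/mapP => -[].
rewrite negb_or eqseq_cons [m == y]eq_sym => /andP[mx ms].
have [->|ym] /= := eqVneq y m.
  case: eqP => //= _; apply/mapP => -[u _ [mx']].
  by rewrite mx' eqxx in mx.
apply/mapP/andP => [[u]|[mt]].
  by rewrite IHs // => /andP[mu /eqP us] [-> ->]; rewrite mu us eqxx.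
rewrite eqseq_cons => /andP[/eqP -> rt].
by exists t; rewrite // IHs // mt.
Qed.

Lemma perm_permutations_cons m s : m \notin s ->
  perm_eq (permutations (m :: s))
          [seq t | s' <- permutations s, t <- insertions m s'].
Proof.
move=> ms.
have ms' s' : s' \in permutations s -> m \notin s'.
  by rewrite mem_permutations => /perm_mem ->.
apply: uniq_perm; first exact: permutations_uniq.
  apply: allpairs_uniq_dep => [|s' /ms'|]; first exact: permutations_uniq.
    exact: insertions_uniq.
  move=> _ _ /allpairsPdep[s1 [t1 [s1P t1P ->]]] /allpairsPdep[s2 [t2 [s2P t2P ->]]].
  rewrite /= => t12; move: t1P t2P; rewrite !mem_insertions ?ms' //.
  by move=> /andP[_ /eqP <-] /andP[_ /eqP <-]; rewrite t12.
move=> t; rewrite mem_permutations; apply/idP/allpairsPdep => [tms|].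
  have mt : m \in t by rewrite (perm_mem tms) mem_head.
  have rP : rem m t \in permutations s.
    by rewrite mem_permutations -(perm_cons m) -(permPl (perm_to_rem mt)).
  by exists (rem m t), t; rewrite mem_insertions ?ms' // mt eqxx.
move=> [s' [u [s'P]]]; rewrite mem_insertions ?ms' // => /andP[mu /eqP us ->].
by rewrite (permPl (perm_to_rem mu)) us perm_cons -mem_permutations.
Qed.

(** The gaps before and after the first letter are handled directly. The
    remaining gaps are those of the tail, its first gap excepted, and they see
    the first letter only through whether it is a peak; the induction hypothesis
    for the tail, preceded by the first letter, gives their sum. *)
Lemma sum_peaks_insertions x m s : x < m -> all (ltn^~ m) s ->
  (\sum_(t <- insertions m s) 'X^(peaks x t) = left_peak_step (size s) 'X^(peaks x s))%R.
Proof.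
have mF u : u < m -> (m < u) = false by move=> um; rewrite ltnNge (ltnW um).
elim: s x => [|y [|z s] IHs] x xm.
- by rewrite /= big_seq1 left_peak_stepXn /= expr0 => _; ring.
- rewrite /= andbT => ym; rewrite !big_cons big_nil left_peak_stepXn /= xm ym mF // andbF.
  by rewrite /= expr0 expr1; ring.
move=> /= /andP[ym /andP[zm sm]].
have {IHs} := IHs y ym; rewrite /= zm => /(_ sm).
rewrite !big_cons -map_comp !big_map /=.
have peaksm u v: u < m -> peaks m (u :: v) = peaks u v.
  by case: v => [|w v] //= um; rewrite mF.
rewrite -![(if s is u :: _ then _ else _) + peaks z s]/(peaks _ (z :: s)).
rewrite !peaksm // !mF // !andbF xm ym zm /=.
set k := (X in left_peak_step (size s).+1 'X^X) => IHs.
rewrite [in X in X = _](eq_bigr _ (fun t _ => exprD _ _ _)) -mulr_sumr.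
(* The summand added and removed is the first gap of the tail. *)
rewrite -[X in (_ * X)%R](addKr 'X^(1 + peaks z s))%R IHs !left_peak_stepXn.
rewrite -/k; have [/andP[_ zy]|_] := boolP ((x < y) && (z < y)); last first.
  by rewrite !add0n !add1n expr0 !exprS -!natr1; ring.
have -> : k = peaks z s.
  by rewrite /k [y < z]ltnNge (ltnW zy); case: (s).
by rewrite !add0n !add1n expr1 !exprS -!natr1; ring.
Qed.

Lemma iota1S n : iota 1 n.+1 = rcons (iota 1 n) n.+1.
Proof. by rewrite -cats1 -{1}[n.+1]addn1 iotaD add1n. Qed.

Lemma left_peak_polyE n :
  left_peak_poly n = (\sum_(s <- permutations (iota 1 n)) 'X^(peaks 0 s))%R.
Proof.
rewrite -(perm_big _ (perm_words n)) big_map big_enum /=.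
by apply: eq_bigr => p _; rewrite lpk_peaks.
Qed.

Lemma left_peak_polyS n : left_peak_poly n.+1 = left_peak_step n (left_peak_poly n).
Proof.
have nP : n.+1 \notin iota 1 n by rewrite mem_iota ltnn andbF.
rewrite !left_peak_polyE iota1S (perm_big [seq t | s <- permutations (iota 1 n), t <- insertions n.+1 s]) /=; last first.
  apply: perm_trans (perm_permutations_cons _ _ nP).
  by apply: perm_permutations; rewrite perm_rcons.
rewrite big_allpairs_dep left_peak_step_sum big_seq [RHS]big_seq; apply: eq_bigr => s.
rewrite mem_permutations => sP.
rewrite sum_peaks_insertions //; first by rewrite (perm_size sP) size_iota.
by apply/allP => i; rewrite (perm_mem sP) mem_iota => /andP[].
Qed.

(** * Tableaux by consecutive rows *)

(** What the partition and column conditions of a tableau impose on two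
    consecutive rows, the lower one being [r1]. *)
Definition dominates (r1 r2 : seq nat) : bool :=
  (size r2 <= size r1) &&
  all (fun k => nth 0 r1 k < nth 0 r2 k) (iota 0 (size r2)).

Lemma dominatesP r1 r2 :
  reflect (size r2 <= size r1 /\ forall k, k < size r2 -> nth 0 r1 k < nth 0 r2 k)
          (dominates r1 r2).
Proof.
apply: (iffP andP) => -[sz r12]; split=> //.
  by move=> k kr2; apply: (allP r12); rewrite mem_iota.
by apply/allP => k; rewrite mem_iota => /r12.
Qed.

Definition tableau (T : seq (seq nat)) : bool :=
  [&& [::] \notin T, sorted dominates T & all (sorted ltn) T].

Lemma column_cons r T k :
  column (r :: T) k = if k <= size r then nth 0 r k.-1 :: column T k else column T k.
Proof. by rewrite /column /=; case: ifP. Qed.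

(** Since the lengths decrease, the column entries of the first two rows are
    adjacent in each column, so that column conditions reduce to conditions on
    consecutive rows, which suit induction on the list of rows. *)
Lemma sorted_columns n T : sorted geq (shape T) -> all (fun r => size r <= n) T ->
  all (fun k => sorted ltn (column T k)) (iota 1 n) = sorted dominates T.
Proof.
elim: T => [|r1 [|r2 T] IHT].
- by move=> _ _; apply/allP.
- by move=> _ _; apply/allP=> k _; rewrite column_cons; case: ifP.
move=> /= /andP[r21 shT] /andP[r1n szT]; rewrite -[path _ _ _]/(sorted _ (r2 :: T)) -IHT //.
have nT k : size r2 < k -> column T k = [::].
  move=> r2k; rewrite /column (_ : filter _ _ = [::]) //; apply/eqP.
  rewrite -[_ == _]negbK -has_filter -all_predC; apply/allP => r rT /=.
  move: shT; rewrite (path_sortedE (rev_trans leq_trans)) => /andP[/allP /(_ (size r))].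
  by rewrite map_f // => /(_ isT) /leq_ltn_trans/(_ r2k); rewrite -ltnNge.
apply/allP/andP => [colT|[/dominatesP[_ r12] /allP colT] k kn].
  split.
    apply/dominatesP; split=> // k kr2; have := colT k.+1.
    rewrite mem_iota !column_cons kr2 (leq_trans kr2 r21) /=.
    case/andP: szT => r2n _.
    by rewrite add1n ltnS (leq_trans kr2 r2n) => /(_ isT) /andP[].
  apply/allP => k /colT; rewrite column_cons; case: ifP => // _; exact: path_sorted.
move: (colT k kn); rewrite !(column_cons r1) column_cons; case: ifP => kr2.
  rewrite (leq_trans kr2 r21) /= => ->; rewrite andbT; move: kn.
  by rewrite mem_iota; case: k kr2 => //= k kr2 _; apply: r12.
by rewrite nT ?ltnNge ?kr2 //; case: ifP.
Qed.

Lemma row_size_le {n T r} : perm_eq (flatten T) (iota 1 n) -> r \in T -> size r <= n.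
Proof.
move=> /perm_size; rewrite size_flatten size_iota => <- rT.
by rewrite sumnE /shape big_map (big_rem r rT) leq_addr.
Qed.

Lemma is_sytE n T : is_syt n T = tableau T && perm_eq (flatten T) (iota 1 n).
Proof.
rewrite /is_syt /tableau; case: (_ \notin T) => //=.
have [pT|] /= := boolP (perm_eq _ _); last by rewrite !andbF.
have szT : all (fun r => size r <= n) T by apply/allP => r /(row_size_le pT).
rewrite andbT; have [shT|nshT] /= := boolP (sorted geq (shape T)).
  by rewrite sorted_columns // [RHS]andbC.
case: (boolP (sorted dominates T)) => //= domT; case/negP: nshT.
by rewrite /shape sorted_map; apply: sub_sorted domT => r1 r2 /andP[].
Qed.

(** * Growing a tableau by its largest entry *)

(** An entry [m] exceeding all others can only extend the first row of its
    length, so the length [c] is enough to say where it goes. The empty row above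
    the tableau plays the part of a row of length 0. *)
Fixpoint grow (T : seq (seq nat)) (c m : nat) : seq (seq nat) :=
  if T is r :: T' then
    if size r == c then rcons r m :: T' else r :: grow T' c m
  else [:: [:: m]].

Lemma perm_flatten_grow T c m : perm_eq (flatten (grow T c m)) (m :: flatten T).
Proof.
elim: T => [|r T IHT] //=; case: ifP => _ /=.
  by rewrite cat_rcons perm_sym -cat1s perm_catCA perm_refl.
by rewrite (perm_catl r IHT) perm_sym -cat1s -[m :: flatten T]cat1s perm_catCA.
Qed.

Lemma perm_shape_grow T c m : c \in 0 :: shape T ->
  perm_eq (shape (grow T c m)) (c.+1 :: rem c (shape T)).
Proof.
elim: T => [|r T IHT] /=; rewrite !inE; first by move=> /eqP ->.
rewrite [_ == size r]eq_sym; have [<-|rc] /= := eqVneq (size r) c.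
  by rewrite size_rcons.
rewrite -in_cons => /IHT; rewrite -(perm_cons (size r)) => /perm_trans; apply.
exact/permEl/(perm_catCA [:: _] [:: _]).
Qed.

Lemma dominates_rcons_l r1 r2 m : all (ltn^~ m) r2 ->
  dominates (rcons r1 m) r2 = dominates r1 r2.
Proof.
move=> r2m; apply/dominatesP/dominatesP; rewrite size_rcons => -[sz r12]; last first.
  by split=> [|k kr2]; [exact: leqW | rewrite nth_rcons (leq_trans kr2 sz) r12].
suff sz' : size r2 <= size r1.
  by split=> // k kr2; have := r12 k kr2; rewrite nth_rcons (leq_trans kr2 sz').
rewrite leqNgt; apply/negP => r12sz; have := r12 _ r12sz.
rewrite nth_rcons ltnn eqxx => mr2; have /= := allP r2m _ (mem_nth 0 r12sz).
by rewrite ltnNge (ltnW mr2).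
Qed.

Lemma dominates_rcons_r r1 r2 m : all (ltn^~ m) r1 ->
  dominates r1 (rcons r2 m) = (size r2 < size r1) && dominates r1 r2.
Proof.
move=> r1m; apply/dominatesP/andP; rewrite size_rcons.
  move=> [sz r12]; split=> //; apply/dominatesP; rewrite ltnW //; split=> // k kr2.
  by have := r12 k (leqW kr2); rewrite nth_rcons kr2.
move=> [sz /dominatesP[_ r12]]; split=> // k; rewrite ltnS leq_eqVlt nth_rcons.
case: ltngtP => //= [kr2 _|-> _]; [exact: r12|].
by apply: (allP r1m); rewrite mem_nth.
Qed.

Lemma sorted_rcons_ltn r m :
  sorted ltn (rcons r m) = all (ltn^~ m) r && sorted ltn r.
Proof. by rewrite !(sorted_pairwise ltn_trans) pairwise_rcons. Qed.

Lemma path_rcons_l r m T : all (ltn^~ m) (flatten T) ->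
  path dominates (rcons r m) T = path dominates r T.
Proof. by case: T => //= r' T; rewrite all_cat => /andP[/dominates_rcons_l ->]. Qed.

(** Lengths decrease weakly upwards. This is what allows a row of length [c]
    above [r] to be extended when [r] is not itself the row that grows. *)
Lemma lt_size_below r T c : r != [::] -> path dominates r T ->
  size r != c -> c \in 0 :: shape T -> c < size r.
Proof.
rewrite -size_eq0 -lt0n inE => r0 domT rc /orP[/eqP ->//|/mapP[r' r'T cr']].
have geT : transitive dominates.
  move=> r2 r1 r3 /dominatesP[sz r12] /dominatesP[sz' r23]; apply/dominatesP.
  split=> [|k kr3]; first exact: leq_trans sz.
  exact: ltn_trans (r12 _ (leq_trans kr3 sz')) (r23 _ kr3).
move: domT; rewrite (path_sortedE geT) => /andP[/allP /(_ _ r'T) /andP[]].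
by rewrite -cr' leq_eqVlt eq_sym (negPf rc).
Qed.

Lemma path_dominates_grow r T c m : [::] \notin T -> all (ltn^~ m) r ->
  all (ltn^~ m) (flatten T) -> c \in 0 :: shape T ->
  path dominates r (grow T c m) = (c < size r) && path dominates r T.
Proof.
elim: T r => [|r' T IHT] r.
  rewrite /= inE andbT => _ rm _ /eqP ->.
  by rewrite -[[:: m]]/(rcons [::] m) dominates_rcons_r.
rewrite /= !inE all_cat negb_or eq_sym => /andP[r'0 T0] rm /andP[r'm Tm].
rewrite [c == size r']eq_sym.
have [<- _|r'c] /= := eqVneq (size r') c.
  by rewrite path_rcons_l // dominates_rcons_r // andbA.
rewrite -in_cons => cT; rewrite (IHT r') // [RHS]andbCA.
case: (boolP (dominates r r')) => //= /andP[r'r _].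
case: (boolP (path _ _ _)) => [domT|]; last by rewrite !andbF.
have cr' := lt_size_below _ _ _ r'0 domT r'c cT.
by rewrite cr' (leq_trans cr' r'r).
Qed.

Lemma tableau_grow T c m : [::] \notin T -> all (ltn^~ m) (flatten T) ->
  c \in 0 :: shape T -> tableau (grow T c m) = tableau T.
Proof.
move=> T0 Tm cT; rewrite /tableau T0.
have -> : [::] \notin grow T c m.
  elim: T T0 {Tm cT} => //= r T IHT; rewrite inE negb_or => /andP[r0 T0].
  case: ifP => _; rewrite inE negb_or ?r0 ?IHT // T0 andbT eq_sym.
  by rewrite -size_eq0 size_rcons.
have -> : all (sorted ltn) (grow T c m) = all (sorted ltn) T.
  elim: T Tm {T0 cT} => //= r T IHT; rewrite all_cat => /andP[rm Tm].
  by case: ifP => _ /=; [rewrite sorted_rcons_ltn rm | rewrite IHT].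
case: T T0 Tm cT => //= r T; rewrite !inE negb_or eq_sym all_cat.
move=> /andP[r0 T0] /andP[rm Tm]; rewrite [c == size r]eq_sym.
have [<- _|rc] /= := eqVneq (size r) c; first by rewrite path_rcons_l.
rewrite -in_cons => cT; rewrite path_dominates_grow //.
case: (boolP (path _ _ _)) => [domT|]; last by rewrite andbF.
by rewrite (lt_size_below r T).
Qed.

(** The maximum ends its row, and the rows above that one are shorter than it:
    an entry above the maximum would exceed it. If the maximum is alone in its
    row then no row lies above. *)
Lemma ungrow T m : tableau T -> uniq (flatten T) -> all (leq^~ m) (flatten T) ->
  m \in flatten T ->
  exists T' c, [/\ [::] \notin T', all (ltn^~ m) (flatten T'),
                   c \in 0 :: shape T' & T = grow T' c m].
Proof.
elim: T => //= r T IHT; rewrite /tableau inE negb_or cat_uniq all_cat mem_cat /=.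
move=> /and3P[/andP[r0 T0] domT /andP[ltr ltT]] /and3P[_ rT uT] /andP[rm Tm] mrT.
have ltm (s : seq nat) : all (leq^~ m) s -> m \notin s -> all (ltn^~ m) s.
  move=> /allP sm ms; apply/allP => i si; rewrite /= ltn_neqAle sm // andbT.
  by apply: contraNneq ms => <-.
have [mr|mr] := boolP (m \in r).
  have mT : m \notin flatten T.
    by apply: contra rT => mT; apply/hasP; exists m.
  have Er : exists r', r = rcons r' m.
    case/lastP: r ltr mr rm {IHT r0 domT rT mrT} => // r' x.
    rewrite sorted_rcons_ltn mem_rcons inE all_rcons => /andP[r'x _].
    case: eqVneq => [<-|_ /= /(allP r'x) /= mx /andP[]]; first by exists r'.
    by rewrite leqNgt mx.
  case: Er => r' Er; move: ltr domT; rewrite Er sorted_rcons_ltn => /andP[r'm _].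
  rewrite path_rcons_l ?ltm //; case: r' r'm {Er} => [|x r'] r'm domT.
    exists [::], 0; split=> //=; case: T domT T0 {IHT ltT rT uT Tm mrT mT} => //= r2 T.
    by rewrite inE /dominates => /andP[/andP[]]; case: r2.
  exists ((x :: r') :: T), (size (x :: r')); split=> //.
  - by rewrite -[flatten _]/((x :: r') ++ flatten T) all_cat r'm ltm.
  - by rewrite !inE eqxx orbT.
  - by rewrite /= eqxx.
have mT : m \in flatten T by move: mrT; rewrite (negPf mr).
case: IHT => //; first by rewrite /tableau T0 ltT (path_sorted domT).
move=> T' [c [T'0 T'm cT' ET]]; exists (r :: T'), c.
move: domT; rewrite ET path_dominates_grow ?(ltm r) // => /andP[cr _].
split; rewrite ?inE ?negb_or ?r0 //=.
- by rewrite all_cat T'm ltm.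
- by move: cT'; rewrite inE => /orP[->|->]; rewrite ?orbT.
- by rewrite gtn_eqF.
Qed.

Lemma restrict_cons i r T :
  restrict i (r :: T) =
  if [seq x <- r | x <= i] is [::] then restrict i T
  else [seq x <- r | x <= i] :: restrict i T.
Proof. by rewrite /restrict /=; case: [seq x <- r | x <= i]. Qed.

Lemma restrict_grow i T c m : i < m -> restrict i (grow T c m) = restrict i T.
Proof.
move=> im; elim: T => [|r T IHT] /=.
  by rewrite restrict_cons /= leqNgt im.
case: ifP => _; rewrite !restrict_cons ?IHT //.
by rewrite filter_rcons leqNgt im.
Qed.

Lemma restrict_id i T : [::] \notin T -> all (leq^~ i) (flatten T) -> restrict i T = T.
Proof.
elim: T => [|r T IHT] //=; rewrite inE all_cat negb_or => /andP[r0 T0] /andP[ri Ti].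
by rewrite restrict_cons (all_filterP ri) IHT //; case: r r0 {ri}.
Qed.

Lemma row_with_cons i r T : row_with i (r :: T) = if i \in r then r else row_with i T.
Proof. by rewrite /row_with /=; case: ifP. Qed.

Lemma index_grow_old i T c m : i != m -> i \in flatten T ->
  index i (row_with i (grow T c m)) = index i (row_with i T).
Proof.
move=> im; elim: T => [|r T IHT] //=; rewrite mem_cat => iT.
case: ifP => _; rewrite !row_with_cons ?mem_rcons ?inE ?(negPf im) /=; case: ifP iT => //= ir.
  by rewrite -cats1 index_cat ir.
Qed.

(** The new box lies in the column with 0-based index [c]. *)
Lemma index_grow_new T c m : m \notin flatten T -> c \in 0 :: shape T ->
  index m (row_with m (grow T c m)) = c.
Proof.
elim: T => [|r T IHT] /=; rewrite ?inE.
  by move=> _ /eqP ->; rewrite row_with_cons inE eqxx /= eqxx.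
rewrite mem_cat negb_or [c == size r]eq_sym => /andP[mr mT].
have [<- _|rc] /= := eqVneq (size r) c.
  by rewrite row_with_cons mem_rcons mem_head -cats1 index_cat (negPf mr) /= eqxx addn0.
by rewrite row_with_cons (negPf mr) -in_cons; apply: IHT.
Qed.

(** * Enumeration of standard Young tableaux *)

Definition syts (n : nat) : seq (seq (seq nat)) := [seq rows T | T in SYT n].

Lemma rows_inj n : injective (@rows n).
Proof.
have inj_row : injective (fun r : {bseq n of 'I_n.+1} => map (@nat_of_ord n.+1) r).
  by move=> r1 r2 /(inj_map val_inj)/val_inj.
by move=> T1 T2 /(inj_map inj_row)/val_inj.
Qed.

Lemma syts_uniq n : uniq (syts n).
Proof. by rewrite map_inj_uniq ?enum_uniq //; apply: rows_inj. Qed.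

Lemma mem_flatten_syt n T i : is_syt n T -> (i \in flatten T) = (0 < i <= n).
Proof. by rewrite is_sytE => /andP[_ /perm_mem ->]; rewrite mem_iota. Qed.

Lemma size_syt n T : is_syt n T -> size T <= n.
Proof.
rewrite is_sytE => /andP[/and3P[T0 _ _] /perm_size].
rewrite size_flatten size_iota => <-.
elim: T T0 => //= r T IHT; rewrite inE negb_or => /andP[r0 /IHT].
by case: r r0 => //= x r _ szT; rewrite addSn ltnS (leq_trans szT) ?leq_addl.
Qed.

Lemma insub_bseqK n (T : Type) (s : seq T) : size s <= n -> insub_bseq n s = s :> seq T.
Proof. by move=> sn; apply: insubdK. Qed.

Lemma mem_syts n T : (T \in syts n) = is_syt n T.
Proof.
apply/mapP/idP => [[F]|sytT]; first by rewrite mem_enum inE => ? ->.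
pose F : filling n := insub_bseq n [seq insub_bseq n (map inord r) | r <- T].
have ET : rows F = T.
  rewrite /rows insub_bseqK; last by rewrite size_map size_syt.
  rewrite -map_comp map_id_in // => r rT /=.
  rewrite insub_bseqK; last first.
    rewrite size_map; move: sytT; rewrite is_sytE => /andP[_ pT].
    exact: row_size_le pT rT.
  rewrite -map_comp map_id_in // => i ir /=; rewrite inordK // ltnS.
  have : i \in flatten T by apply/flattenP; exists r.
  by rewrite (mem_flatten_syt _ _ _ sytT) => /andP[].
by exists F; rewrite // mem_enum inE ET.
Qed.

(** The row lengths that can grow, 0 standing for a new row. *)
Definition corners (T : seq (seq nat)) : seq nat := undup (0 :: shape T).

Lemma is_syt_grow n T c : is_syt n T -> c \in 0 :: shape T ->
  is_syt n.+1 (grow T c n.+1).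
Proof.
move=> sytT cT; move: (sytT); rewrite !is_sytE => /andP[tabT pT].
rewrite tableau_grow //; first 1 last.
- by case/and3P: tabT.
- by apply/allP => i; rewrite (mem_flatten_syt _ _ _ sytT) => /andP[].
rewrite tabT (permPl (perm_flatten_grow _ _ _)) iota1S.
by rewrite perm_sym perm_rcons perm_cons perm_sym.
Qed.

Lemma restrict_syt_grow n T c : is_syt n T -> restrict n (grow T c n.+1) = T.
Proof.
move=> sytT; rewrite restrict_grow // restrict_id //.
  by move: sytT; rewrite is_sytE => /andP[/and3P[]].
by apply/allP => i; rewrite (mem_flatten_syt _ _ _ sytT) => /andP[].
Qed.

(** Injectivity holds because deleting the entry n+1 recovers the tableau, and
    the column of n+1 recovers [c]; surjectivity is [ungrow]. *)
Lemma perm_syts n :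
  perm_eq (syts n.+1) [seq grow T c n.+1 | T <- syts n, c <- corners T].
Proof.
have memc T c : c \in corners T -> c \in 0 :: shape T by rewrite mem_undup.
apply: uniq_perm; first exact: syts_uniq.
  apply: allpairs_uniq_dep => [|T _|]; [exact: syts_uniq|exact: undup_uniq|].
  move=> _ _ /allpairsPdep[T1 [c1 [T1P /memc c1P ->]]] /allpairsPdep[T2 [c2 [T2P /memc c2P ->]]].
  move: T1P T2P; rewrite /= !mem_syts => T1P T2P eT.
  have eT12 : T1 = T2.
    by rewrite -(restrict_syt_grow n T1 c1) // eT restrict_syt_grow.
  rewrite -eT12 in c2P eT *; congr (Tagged _ _).
  have nT1 : n.+1 \notin flatten T1 by rewrite (mem_flatten_syt n) // ltnn andbF.
  by rewrite -(index_grow_new T1 c1 n.+1) // eT index_grow_new.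
move=> T; rewrite mem_syts; apply/idP/allpairsPdep => [sytT|]; last first.
  by move=> [T' [c [T'P /memc cP ->]]]; rewrite is_syt_grow // -mem_syts.
have [||||T' [c [T'0 T'n cT' ET]]] := ungrow T n.+1.
- by move: sytT; rewrite is_sytE => /andP[].
- by move: sytT; rewrite is_sytE => /andP[_ /perm_uniq ->]; rewrite iota_uniq.
- by apply/allP => i; rewrite (mem_flatten_syt _ _ _ sytT) => /andP[].
- by rewrite (mem_flatten_syt _ _ _ sytT) /= ltnSn.
exists T', c; split=> //; last by rewrite mem_undup.
move: sytT; rewrite mem_syts !is_sytE ET tableau_grow // => /andP[-> pT].
move: pT; rewrite andTb (permPl (perm_flatten_grow _ _ _)) iota1S.
by rewrite perm_sym perm_rcons perm_cons perm_sym.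
Qed.

(** * Sorting indices and the exponent under growth *)

Lemma sigma_grow_old i n T c : is_syt n T -> 0 < i <= n ->
  sigma i (grow T c n.+1) = sigma i T.
Proof.
move=> sytT iP; case/andP: (iP) => i0 iln; rewrite /sigma restrict_grow ?ltnS //.
by rewrite index_grow_old ?(mem_flatten_syt n) // ltn_eqF.
Qed.

Lemma col_shape k T : Defs.col k T = count (leq k) (shape T).
Proof. by rewrite /Defs.col /column size_map size_filter count_map. Qed.

(** For c > 0, columns c and c+1 of [T] differ by the number of its rows of
    length c. The new box adds one to column c+1, and the index adds one back. *)
Lemma sigma_grow_new n T c : is_syt n T -> c \in 0 :: shape T ->
  sigma n.+1 (grow T c n.+1) =
  if c == 0 then n.+1 - size T else count_mem c (shape T).
Proof.
move=> sytT cT.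
have nT : n.+1 \notin flatten T by rewrite (mem_flatten_syt n) // ltnn andbF.
have /and3P[T'0 _ _] : tableau (grow T c n.+1).
  by move: (is_syt_grow _ _ _ sytT cT); rewrite is_sytE => /andP[].
have shc k : count (leq k) (shape (grow T c n.+1)) =
    (k <= c.+1) + (count (leq k) (shape T) - (c \in shape T) && (k <= c)).
  by rewrite (seq.permP (perm_shape_grow T c n.+1 cT)) /= count_rem.
rewrite /sigma index_grow_new // restrict_id //; last first.
  apply/allP => i; rewrite (perm_mem (perm_flatten_grow _ _ _)) inE.
  by rewrite (mem_flatten_syt n) // => /orP[/eqP ->|/andP[_ /leqW]].
clear T'0.
have corner : 0 < c -> 0 < count_mem c (shape T).
  by rewrite lt0n -has_count has_pred1; move: cT; rewrite inE; case: eqP.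
have countS k : count (leq k) (shape T) = count_mem k (shape T) + count (leq k.+1) (shape T).
  by elim: (shape T) => //= a s ->; rewrite eq_sym; case: ltngtP => _; lia.
have szT := size_syt _ _ sytT.
case: c cT shc corner {nT} => [|c] cT shc corner; rewrite !col_shape !shc /=.
  rewrite (_ : count (leq 1) (shape T) = size T); last first.
    move: sytT; rewrite is_sytE => /andP[/and3P[T0 _ _] _].
    by elim: (T) T0 => //= r s IHs; rewrite inE negb_or eq_sym -size_eq0 -lt0n => /andP[-> /IHs ->].
  by rewrite andbF subn0; lia.
rewrite (countS c.+1) leqnn leqnSn ltnn andbF andbT.
have cT' : c.+1 \in shape T by move: cT; rewrite inE.
move: (corner isT); rewrite cT' ltnSn /=; case: (count_mem _ _) => // a _.
by move: (count (leq _) _) => b; lia.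
Qed.

Definition half_size (s : seq nat) : nat := \sum_(k <- s) k./2.

Lemma sum_odd_half s : \sum_(k <- s) k = \sum_(k <- s) odd k + (half_size s).*2.
Proof.
rewrite /half_size -muln2 big_distrl -big_split; apply: eq_bigr => k _ /=.
by rewrite muln2 odd_double_half.
Qed.

Lemma sum_syt n T : is_syt n T -> \sum_(k <- shape T) k = n.
Proof.
rewrite is_sytE => /andP[_ /perm_size].
by rewrite size_flatten sumnE size_iota.
Qed.

Lemma sum_bool_count (I : Type) (r : seq I) (P : pred I) :
  \sum_(i <- r) P i = count P r.
Proof. by rewrite -sum1_count [RHS]big_mkcond; apply: eq_bigr => i _; case: (P i). Qed.

(** As n is the sum of the row lengths, removing one for each odd row leaves
    twice the sum of the halves. *)
Lemma lpk_exponentE n T : is_syt n T -> lpk_exponent n T = half_size (shape T).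
Proof.
move=> sytT; rewrite /lpk_exponent.
have -> : \sum_(0 <= i < n) w i.*2.+1 T = \sum_(k <- shape T) odd k.
  have -> : \sum_(0 <= i < n) w i.*2.+1 T =
       \sum_(0 <= i < n) \sum_(k <- shape T) (k == i.*2.+1).
    by apply: eq_bigr => i _; rewrite big_map sum_bool_count.
  rewrite exchange_big /= big_seq [RHS]big_seq; apply: eq_bigr => k kT.
  have kn : k <= n.
    case/mapP: kT => r rT ->; move: sytT; rewrite is_sytE => /andP[_ pT].
    exact: row_size_le pT rT.
  rewrite sum_bool_count; have [ok|ek] := boolP (odd k).
    rewrite (eq_count (a2 := pred1 k./2)) => [|i /=]; last by lia.
    by rewrite count_uniq_mem ?iota_uniq // mem_index_iota; lia.
  by rewrite (eq_count (a2 := pred0)) ?count_pred0 // => i /=; lia.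
by rewrite -{1}(sum_syt _ _ sytT) sum_odd_half addKn doubleK.
Qed.

Lemma half_size_grow T c m : c \in 0 :: shape T ->
  half_size (shape (grow T c m)) = half_size (shape T) + odd c.
Proof.
move=> cT; rewrite /half_size (perm_big _ (perm_shape_grow _ _ _ cT)) big_cons /=.
have [->|c0] := eqVneq c 0.
  have [s0|s0] := boolP (0 \in shape T); last by rewrite rem_id // addn0.
  by rewrite [in RHS](big_rem 0) //= addn0.
have cs : c \in shape T by move: cT; rewrite inE (negPf c0).
rewrite [in RHS](big_rem c) //= uphalf_half; lia.
Qed.

Lemma sum_odd_powers h (s : seq nat) :
  (\sum_(c <- s) 'X^(h + odd c) =
   'X^h * ((size s)%:R + (\sum_(c <- s) odd c)%N%:R * ('X - 1)) :> {poly int})%R.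
Proof.
elim: s => [|c s IHs]; first by rewrite !big_nil mul0r addr0 mulr0.
rewrite !big_cons IHs exprD /= -[((size s).+1%:R)%R]natr1 natrD.
by case: (odd c); rewrite ?expr0 ?expr1 ?mulr0n ?mulr1n; ring.
Qed.

(** The multiplicities turn the sum over distinct lengths into a sum over rows,
    and the number of odd rows is n minus twice the exponent. *)
Lemma sum_corners n T : is_syt n T ->
  (\sum_(c <- corners T) 'X^(half_size (shape T) + odd c) *+
     (if c == 0%N then n.+1 - size T else count_mem c (shape T))%N =
   left_peak_step n ('X^(half_size (shape T))))%R.
Proof.
move=> sytT; have szT := size_syt _ _ sytT.
have s0 : 0 \notin shape T.
  apply/mapP => -[r rT /esym/size0nil r0]; move: sytT; rewrite is_sytE r0 in rT *.
  by rewrite /tableau rT.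
rewrite /corners /= (negPf s0) big_cons eqxx addn0.
have -> : (\sum_(c <- undup (shape T)) 'X^(half_size (shape T) + odd c) *+
     (if c == 0%N then n.+1 - size T else count_mem c (shape T))%N =
     \sum_(c <- shape T) 'X^(half_size (shape T) + odd c) :> {poly int})%R.
  rewrite -[RHS]big_undup_iterop_count /= [LHS]big_seq [RHS]big_seq; apply: eq_bigr => c.
  by rewrite mem_undup; case: eqP => // -> c0; rewrite c0 in s0.
rewrite sum_odd_powers left_peak_stepXn size_map -mulr_natr natrB ?leqW // exprS.
rewrite -(sum_syt _ _ sytT) sum_odd_half -natr1 natrD -muln2 natrM; ring.
Qed.

(** * The two recurrences agree *)

Definition syt_sum n : {poly int} :=
  (\sum_(T in SYT n)
     'X^(lpk_exponent n (rows T)) *+ (\prod_(1 <= i < n.+1) sigma i (rows T))%N)%R.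

Lemma syt_sumE n : syt_sum n =
  (\sum_(T <- syts n) 'X^(half_size (shape T)) *+
     (\prod_(1 <= i < n.+1) sigma i T)%N)%R.
Proof.
rewrite /syts big_map /syt_sum -big_enum /= big_seq [RHS]big_seq.
by apply: eq_bigr => T; rewrite mem_enum inE => sytT; rewrite lpk_exponentE.
Qed.

Lemma syt_sumS n : syt_sum n.+1 = left_peak_step n (syt_sum n).
Proof.
rewrite !syt_sumE (perm_big _ (perm_syts n)) big_allpairs_dep left_peak_step_sum.
rewrite big_seq [RHS]big_seq; apply: eq_bigr => T; rewrite mem_syts => sytT.
rewrite left_peak_stepMn -sum_corners // -sumrMnl big_seq [RHS]big_seq.
apply: eq_bigr => c; rewrite mem_undup => cT.
rewrite half_size_grow // big_nat_recr //= sigma_grow_new // mulnC mulrnA.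
congr (_ *+ _)%R; apply: eq_big_nat => i iP.
by rewrite (sigma_grow_old _ n).
Qed.

Lemma syt_sum0 : syt_sum 0 = 1%R.
Proof.
have -> : syt_sum 0 = (\sum_(T <- [:: [::]]) 'X^(half_size (shape T)) *+
     (\prod_(1 <= i < 1) sigma i T)%N)%R.
  rewrite syt_sumE; apply/perm_big/uniq_perm => // [|T]; first exact: syts_uniq.
  rewrite mem_syts inE; apply/idP/eqP => [/size_syt|-> //].
  by rewrite leqn0 => /nilP.
by rewrite big_seq1 big_geq // /half_size big_nil expr0.
Qed.

Theorem theorem33 (n : nat) (hn : 1 <= n) :
  left_peak_poly n =
  (\sum_(T in SYT n)
     'X^(lpk_exponent n (rows T)) *+ (\prod_(1 <= i < n.+1) sigma i (rows T))%N)%R.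
Proof.
rewrite -/(syt_sum n) {hn}; elim: n => [|n IHn].
  by rewrite syt_sum0 left_peak_polyE /= big_seq1.
by rewrite left_peak_polyS IHn syt_sumS.
Qed.
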